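(* There exists a Banach space $X$ with the $r$-big slice property (hence $\mathcal T^s(X)\geq1$) and there exists $\varphi\in S_{X^*}$ such that $$\inf_{\alpha>0}\operatorname{diam}\big(S(B_X,\varphi,\alpha)\big)\leq\sqrt2.$$
   Context: All Banach spaces are nontrivial and real. $B_X$ and $S_X$ denote the closed unit ball and the unit sphere of $X$, $X^*$ is the dual, and $B(x,r)$ is the ball with center $x$ and radius $r$. A slice of $B_X$ is a set $S(B_X,x^*,\alpha)=\{x\in B_X: x^*(x)>1-\alpha\}$ with $x^*\in S_{X^*}$ and $\alpha>0$. For a bounded subset $C$ of $X$, the radius of $C$ is $r(C)=\inf\{r>0: C\subseteq B(x,r)\text{ for some }x\in X\}$. $X$ has the $r$-big slice property if every slice of $B_X$ has radius one (here ''$r$'' is just part of the name). $\mathcal T^s(X)=\inf\{r>0:$ there exist $x\in S_X$ and a slice $S$ of $B_X$ such that $S\subset B(x,r)\}$. *)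

(* Defs.v *)
From HB Require Import structures.
From mathcomp Require Import all_boot all_order all_algebra.
From mathcomp Require Import all_classical all_reals ereal topology normedtype.

Set Implicit Arguments.
Unset Strict Implicit.
Unset Printing Implicit Defensive.

Import Order.TTheory GRing.Theory Num.Theory.
Import numFieldNormedType.Exports.

Local Open Scope classical_set_scope.
Local Open Scope ring_scope.

(* Radii, diameters, norms of functionals and the index Ts are computed in
   \bar R, so that no infimum or supremum takes a default value. *)

Definition nontrivial (R : realType) (X : normedModType R) : Prop :=
  exists x : X, x != 0.

Definition unit_ball (R : realType) (X : normedModType R) : set X :=
  [set x | `|x| <= 1].

Definition unit_sphere (R : realType) (X : normedModType R) : set X :=
  [set x | `|x| = 1].

Definition dual_norm (R : realType) (X : normedModType R)
    (f : {linear X -> R^o}) : \bar R :=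
  ereal_sup [set (`|f x|)%:E | x in @unit_ball R X].

Definition dual_sphere (R : realType) (X : normedModType R) :
    set {linear X -> R^o} :=
  [set f : {linear X -> R^o} | continuous f /\ dual_norm f = 1%:E].

Definition slice (R : realType) (X : normedModType R)
    (f : {linear X -> R^o}) (a : R) : set X :=
  [set x | unit_ball x /\ 1 - a < f x].

Definition is_slice (R : realType) (X : normedModType R) (S : set X) : Prop :=
  exists f : {linear X -> R^o}, exists a : R,
    [/\ dual_sphere f, 0 < a & S = slice f a].

(* Whether the balls are open or closed does not affect [radius] and [Ts]. *)
Definition radius (R : realType) (X : normedModType R) (C : set X) : \bar R :=
  ereal_inf [set r%:E | r in
    [set r : R | 0 < r /\ exists x : X, C `<=` closed_ball x r]].

Definition r_big_slice_property (R : realType) (X : normedModType R) : Prop :=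
  forall S : set X, is_slice S -> radius S = 1%:E.

Definition Ts (R : realType) (X : normedModType R) : \bar R :=
  ereal_inf [set r%:E | r in
    [set r : R | 0 < r /\
      exists x : X, exists S : set X,
        [/\ unit_sphere x, is_slice S & S `<=` closed_ball x r]]].

(* Meaningful for nonempty sets only (the value at [set0] is -oo); slices given
   by functionals of norm one are nonempty. *)
Definition diam (R : realType) (X : normedModType R) (C : set X) : \bar R :=
  ereal_sup [set (`|p.1 - p.2|)%:E | p in C `*` C].

(* Main.v *)
(**
The space is [L^1] of an atomless probability space with the equivalent norm
[N f = sup_A |\int_A f| = max (\int f^+) (\int f^-)].

If [N F <= 1], [N G <= 1] and [\int G > 1 - a], then
[F(B) - G(B) = F(B) - \int G + G(~B) < 1 + a] for every [B], so the slices of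
the functional [\int] have diameter at most [1 + a].

On the other hand, split the space into [m] sets [E_j], each carrying [1/m] of
[h], of its positive part and of its negative part.  Then [h] is the average of
the [h_j := m h 1_{E_j}], and [N h_j = N h], so any slice containing [h] contains
some [h_j].  If [E_j] moreover carries only [1/m] of [y], then, testing on subsets
of [E_j], [N (h_j - y) >= N h - N y / m].  Hence no ball of radius less than [1]
contains a slice.

Concretely, an element is the set function [A |-> mean (h 1_A)] of a periodic
density [h] on [nat], with [A] a periodic subset of [nat], or a uniform limit of
such set functions; a [p]-periodic density is split by the residue modulo [m] of
[k %/ p].
*)
Require Import Defs.
From HB Require Import structures.
From mathcomp Require Import all_boot all_order all_algebra.
From mathcomp Require Import all_classical all_reals ereal topology normedtype.
From mathcomp Require Import zify ring lra.

Set Implicit Arguments.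
Unset Strict Implicit.
Unset Printing Implicit Defensive.

Import Order.TTheory GRing.Theory Num.Theory.
Import numFieldNormedType.Exports.

Local Open Scope classical_set_scope.
Local Open Scope ring_scope.

(** * Periodic functions on the natural numbers *)

Definition period (T : Type) (p : nat) (h : nat -> T) : Prop :=
  (0 < p)%N /\ forall k, h (k + p)%N = h k.

Definition periodic (T : Type) (h : nat -> T) : Prop := exists p, period p h.

Section Period.
Variable T : Type.
Implicit Types h : nat -> T.

Lemma period_addM p h i k : period p h -> h (i * p + k)%N = h k.
Proof.
move=> [_ hp]; elim: i => [|i IH]; first by rewrite mul0n add0n.
by rewrite mulSn -addnA addnC hp IH.
Qed.

Lemma period_mull m p h : (0 < m)%N -> period p h -> period (m * p) h.
Proof.
move=> m0 hp; have [p0 _] := hp; split; first by rewrite muln_gt0 m0.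
by move=> k; rewrite addnC (period_addM m k hp).
Qed.

Lemma period_mulr m p h : (0 < m)%N -> period p h -> period (p * m) h.
Proof. by rewrite mulnC; exact: period_mull. Qed.

Lemma period_comp U (f : T -> U) p h : period p h -> period p (f \o h).
Proof. by move=> [p0 hp]; split => // k /=; rewrite hp. Qed.

Lemma period_op2 U W (f : T -> U -> W) p h (g : nat -> U) :
  period p h -> period p g -> period p (fun k => f (h k) (g k)).
Proof. by move=> [p0 hp] [_ gp]; split => // k; rewrite hp gp. Qed.

Lemma period_cst p (c : T) : (0 < p)%N -> period p (fun=> c).
Proof. by []. Qed.

End Period.

Lemma common_period T U (h : nat -> T) (g : nat -> U) :
  periodic h -> periodic g -> exists p, period p h /\ period p g.
Proof.
move=> [p hp] [q gq]; exists (p * q)%N.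
by split; [apply: period_mulr => //; case: gq|apply: period_mull => //; case: hp].
Qed.

Lemma periodic_op2 T U W (f : T -> U -> W) (h : nat -> T) (g : nat -> U) :
  periodic h -> periodic g -> periodic (fun k => f (h k) (g k)).
Proof.
by move=> hp gp; have [p [? ?]] := common_period hp gp; exists p; exact: period_op2.
Qed.

Lemma periodic_comp T U (f : T -> U) (h : nat -> T) : periodic h -> periodic (f \o h).
Proof. by move=> [p hp]; exists p; exact: period_comp. Qed.

(** Made of whole runs of length [p], one run out of every [m], so that a [p]-periodic function
    looks the same on each block. *)
Definition block (p m j : nat) : nat -> bool := fun k => ((k %/ p) %% m == j)%N.

Lemma block_period p m j : (0 < p)%N -> (0 < m)%N -> period (m * p) (block p m j).
Proof.
move=> p0 m0; split; first by rewrite muln_gt0 m0.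
by move=> k; rewrite /block addnC divnMDl// modnDl.
Qed.

(** * The mean of a periodic real function *)

Section Mean.
Variable R : realType.
Implicit Types h g : nat -> R.

Definition avg (p : nat) h : R := p%:R^-1 * \sum_(k < p) h k.

Lemma sum_blocks (V : nmodType) (F : nat -> V) m p :
  \sum_(k < m * p) F k = \sum_(i < m) \sum_(r < p) F (i * p + r)%N.
Proof.
elim: m => [|m IH]; first by rewrite mul0n !big_ord0.
by rewrite big_ord_recr -IH mulSnr big_split_ord.
Qed.

Lemma avg_mul m p h : (0 < m)%N -> period p h -> avg (m * p) h = avg p h.
Proof.
move=> m0 hp; have [p0 _] := hp; rewrite /avg sum_blocks.
under eq_bigr do under eq_bigr do rewrite (period_addM _ _ hp).
rewrite sumr_const card_ord -[_ *+ m]mulr_natl natrM.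
by field; rewrite !pnatr_eq0; lia.
Qed.

(* Junk: [avg 1 h], the value [h 0], if [h] is not periodic. *)
Definition mean h : R := avg (xget 1%N [set p | period p h]) h.

(** Any two periods [p] and [q] give the same average, since both agree with the average over
    [p * q]. *)
Lemma meanE p h : period p h -> mean h = avg p h.
Proof.
move=> hp; rewrite /mean; case: xgetP => [q _ hq|/(_ p)]; last by case.
have [p0 _] := hp; have [q0 _] := hq.
by rewrite -(avg_mul p0 hq) mulnC avg_mul.
Qed.

Lemma le_mean h g : periodic h -> periodic g -> (forall k, h k <= g k) ->
  mean h <= mean g.
Proof.
move=> hP gP hg; have [p [hp gp]] := common_period hP gP.
rewrite (meanE hp) (meanE gp) ler_wpM2l ?invr_ge0//.
by apply: ler_sum => i _; exact: hg.
Qed.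

Lemma meanD h g : periodic h -> periodic g ->
  mean (fun k => h k + g k) = mean h + mean g.
Proof.
move=> hP gP; have [p [hp gp]] := common_period hP gP.
rewrite (meanE hp) (meanE gp) (meanE (period_op2 _ hp gp)).
by rewrite /avg big_split mulrDr.
Qed.

Lemma meanZ c h : periodic h -> mean (fun k => c * h k) = c * mean h.
Proof.
move=> [p hp]; rewrite (meanE hp) (meanE (period_comp (fun x => c * x) hp)).
by rewrite /avg -mulr_sumr mulrCA.
Qed.

Lemma mean_cst c : mean (fun=> c) = c.
Proof. by rewrite (meanE (@period_cst _ 1%N c _))// /avg big_ord1 invr1 mul1r. Qed.

(** Within one period [m * p] the block is a single run of length [p]. The sum over it is the sum of
    [h] over one period, and the longer averaging range contributes the factor 1/m. *)
Lemma mean_block p m j h : (j < m)%N -> period p h ->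
  mean (fun k => h k * (block p m j k)%:R) = m%:R^-1 * mean h.
Proof.
move=> jm hp; have [p0 _] := hp; have m0 : (0 < m)%N by lia.
have P := period_op2 (fun x (b : bool) => x * b%:R) (period_mull m0 hp)
  (block_period j p0 m0).
rewrite (meanE P) (meanE hp) /avg.
rewrite (sum_blocks (fun k => h k * (block p m j k)%:R)) natrM invfM -mulrA.
congr (_ * (_ * _)).
rewrite (bigD1 (Ordinal jm)) //= [X in _ + X]big1 ?addr0; last first.
  move=> i ij; rewrite big1// => r _; rewrite /block.
  rewrite divnMDl// divn_small// addn0 modn_small//.
  by rewrite (_ : (_ == _) = false) ?mulr0//; apply/negbTE: ij.
apply: eq_bigr => r _; rewrite (period_addM _ _ hp) /block.
by rewrite divnMDl// divn_small// addn0 modn_small// eqxx mulr1.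
Qed.

End Mean.

(** * Set functions with periodic density, and their uniform closure *)

Definition periodic_set := {A : nat -> bool | periodic A}.

Section Density.
Variable R : realType.
Implicit Types (h g : nat -> R) (A : periodic_set).

Definition density h : periodic_set -> R^o :=
  fun A => mean (fun k => h k * (sval A k)%:R).

Lemma periodic_restrict h A :
  periodic h -> periodic (fun k => h k * (sval A k)%:R).
Proof.
by move=> hP; apply: (periodic_op2 (fun x (b : bool) => x * b%:R)) => //; case: A.
Qed.

Lemma densityD h g : periodic h -> periodic g ->
  density (fun k => h k + g k) = density h + density g.
Proof.
move=> hP gP; apply/funext => A.
rewrite /density fctE -meanD; [|exact: periodic_restrict..].
by congr mean; apply/funext => k; rewrite mulrDl.
Qed.

Lemma densityZ c h : periodic h -> density (fun k => c * h k) = c *: density h.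
Proof.
move=> hP; apply/funext => A.
rewrite /density fctE /= -[RHS](meanZ c (periodic_restrict A hP)).
by congr mean; apply/funext => k; rewrite mulrA.
Qed.

Lemma le_norm_density h A : periodic h -> `|density h A| <= mean (fun k => `|h k|).
Proof.
move=> hP; have nP : periodic (fun k => `|h k|).
  exact: (periodic_comp Num.norm hP).
have rP := periodic_restrict A hP.
have le k : `|h k * (sval A k)%:R| <= `|h k|.
  by case: (sval A k); rewrite ?mulr1 ?mulr0 ?normr0.
rewrite ler_norml; apply/andP; split.
  rewrite lerNl -mulN1r -(meanZ _ rP); apply: le_mean => //.
    exact: (periodic_comp (fun x => -1 * x) rP).
  by move=> k; rewrite mulN1r (le_trans _ (le k))// -normrN ler_norm.
by apply: le_mean => // k; exact: le_trans (ler_norm _) (le k).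
Qed.

(** Taking the uniform limits realizes the completion concretely, as a submodule of the functions on
    periodic sets. *)
Definition density_closure : {pred periodic_set -> R^o} :=
  [pred F | `[< forall e : R, 0 < e ->
    exists2 h, periodic h & forall A, `|F A - density h A| <= e >]].

Lemma density_closureP (F : periodic_set -> R^o) : reflect
  (forall e : R, 0 < e ->
    exists2 h, periodic h & forall A, `|F A - density h A| <= e)
  (F \in density_closure).
Proof. exact: asboolP. Qed.

Lemma density_closed h : periodic h -> density h \in density_closure.
Proof.
by move=> hP; apply/density_closureP => e e0; exists h => // A; rewrite subrr normr0 ltW.
Qed.

Lemma density_closure_submod : submod_closed density_closure.
Proof.
split.
  have -> : (0 : periodic_set -> R^o) = density (fun=> 0).
    by apply/funext => A; rewrite /density (_ : (fun _ => _) = fun=> 0) ?mean_cst//;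
      apply/funext => k; rewrite mul0r.
  by apply: density_closed; exists 1%N.
move=> c F G /density_closureP cF /density_closureP cG.
apply/density_closureP => e e0.
(* The term |c| + 1 replaces |c| so that the tolerance stays positive when [c] is 0. *)
have d0 : 0 < e / 2 / (`|c| + 1) by rewrite !divr_gt0// ltr_wpDl.
have [h hP Fh] := cF _ d0; have [|g gP Gg] := cG (e / 2); first by lra.
have chP : periodic (fun k => c * h k).
  exact: (periodic_comp (fun x => c * x) hP).
exists (fun k => c * h k + g k).
  exact: (periodic_op2 (fun x y => x + y)).
move=> A; rewrite densityD// densityZ// !fctE.
rewrite (_ : _ - _ = c *: (F A - density h A) + (G A - density g A)); last first.
  by rewrite scalerBr opprD addrACA.
rewrite (le_trans (ler_normD _ _))// normrZ [leRHS](splitr e) lerD//.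
have := Fh A; rewrite ler_pdivlMr ?ltr_wpDl// => /(le_trans _); apply.
by rewrite mulrC ler_wpM2l// lerDl.
Qed.

HB.instance Definition _ := GRing.isSubmodClosed.Build R (periodic_set -> R^o)
  density_closure density_closure_submod.

Record diffuse := Diffuse {
  charge_of :> periodic_set -> R^o;
  charge_ofP : charge_of \in density_closure }.

HB.instance Definition _ := [isSub for charge_of].
HB.instance Definition _ := [Choice of diffuse by <:].
HB.instance Definition _ := [SubChoice_isSubLmodule of diffuse by <:].

End Density.

(** * The supremum norm and completeness *)

Section Diffuse.
Variable R : realType.
Implicit Types (F G : diffuse R) (A : periodic_set) (h : nat -> R).

Definition full_set : periodic_set :=
  exist _ (fun=> true) (ex_intro _ 1%N (@period_cst bool 1 true isT)).

Lemma charge_ofD F G A : charge_of (F + G) A = F A + G A.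
Proof. by []. Qed.

Lemma charge_ofZ c F A : charge_of (c *: F) A = c * F A.
Proof. by []. Qed.

Lemma charge_ofB F G A : charge_of (F - G) A = F A - G A.
Proof. by []. Qed.

Definition sup_norm F : R := sup (range (fun A => `|F A|)).

(** Guarantees that the real-valued [sup] in [sup_norm] is a genuine supremum and not a default
    value. *)
Lemma charge_bounded F : exists c, forall A, `|F A| <= c.
Proof.
have /density_closureP/(_ 1 ltr01)[h hP Fh] := charge_ofP F.
exists (1 + mean (fun k => `|h k|)) => A.
by rewrite -[F A](subrK (density h A)) (le_trans (ler_normD _ _))// lerD ?le_norm_density.
Qed.

Lemma le_sup_norm F A : `|F A| <= sup_norm F.
Proof.
have [c Fc] := charge_bounded F.
by apply: ub_le_sup; [exists c => _ [B _ <-]|exists A].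
Qed.

Lemma sup_norm_le F c : (forall A, `|F A| <= c) -> sup_norm F <= c.
Proof.
move=> Fc; apply: ge_sup; first by exists `|F full_set|; exists full_set.
by move=> _ [A _ <-].
Qed.

Lemma sup_norm_ge0 F : 0 <= sup_norm F.
Proof. exact: le_trans (normr_ge0 _) (le_sup_norm F full_set). Qed.

Lemma ler_sup_normD F G : sup_norm (F + G) <= sup_norm F + sup_norm G.
Proof.
apply: sup_norm_le => A; rewrite charge_ofD.
by rewrite (le_trans (ler_normD _ _))// lerD// le_sup_norm.
Qed.

(** The reverse inequality is the easy one, applied to the scalar [c^-1] and the element
    [c *: F]. *)
Lemma sup_normZ c F : sup_norm (c *: F) = `|c| * sup_norm F.
Proof.
have le d G : sup_norm (d *: G) <= `|d| * sup_norm G.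
  by apply: sup_norm_le => A; rewrite charge_ofZ normrM ler_wpM2l// le_sup_norm.
apply/eqP; rewrite eq_le le/=.
have [->|c0] := eqVneq c 0; first by rewrite normr0 mul0r sup_norm_ge0.
rewrite -ler_pdivlMl ?normr_gt0//.
by rewrite -[X in sup_norm X <= _](scalerK c0) -normfV.
Qed.

Lemma sup_norm_eq0 F : sup_norm F = 0 -> F = 0.
Proof.
move=> F0; apply/val_inj/funext => A; apply/eqP.
by rewrite -normr_le0 -F0; exact: le_sup_norm.
Qed.

HB.instance Definition _ := Lmodule_isNormed.Build R (diffuse R)
  ler_sup_normD sup_normZ sup_norm_eq0.

(** The limit is taken at each set separately. The Cauchy property makes the convergence uniform, so
    the limit remains in the closure. *)
Lemma diffuse_complete (FF : set_system (diffuse R)) :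
  ProperFilter FF -> cauchy FF -> cvg FF.
Proof.
move=> FP /cauchy_ballP Fc.
pose G A : R^o := lim ((fun F : diffuse R => F A) @ FF).
have Gcvg A : (fun F : diffuse R => F A : R) @ FF --> (G A : R).
  apply/cauchy_cvgP/cauchy_ballP => e e0; near_simpl.
  have := Fc e e0; apply: filterS => -[F F'] /=.
  rewrite -!ball_normE /= => H; apply: le_lt_trans H.
  by rewrite -charge_ofB; exact: le_sup_norm.
(* Most [F] are within [e] of most [F']; at a given [A], some such [F'] is within [d] of the limit,
   and [d] is arbitrary. *)
have near_lim (e : R) : 0 < e -> 
      FF [set F : diffuse R | forall A, `|F A - G A| <= e].
  move=> e0; apply: (filterS _ (nearP_dep (Fc e e0))) => F FF' A.
  apply/ler_addgt0Pr => d d0.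
  have [F' [F'G F'F]] : exists F', `|G A - F' A| < d /\ ball F e F'.
    apply: (@filter_ex _ FF); apply: filterI => //.
    by move/cvgrPdist_lt: (Gcvg A) => /(_ d d0).
  rewrite (le_trans (ler_distD (F' A) _ _))// lerD//; last by rewrite distrC ltW.
  move: F'F; rewrite -ball_normE /= => /ltW; apply: le_trans.
  by rewrite -charge_ofB; exact: le_sup_norm.
have GP : G \in density_closure (R:=R).
  apply/density_closureP => e e0.
  have e20 : 0 < e / 2 by lra.
  have [F FG] := filter_ex (near_lim _ e20).
  have /density_closureP/(_ _ e20)[h hP Fh] := charge_ofP F.
  exists h => // A; rewrite (le_trans (ler_distD (F A) _ _))// [leRHS]splitr lerD//.
  by rewrite distrC.
apply/cvg_ex; exists (Diffuse GP); apply/cvgrPdist_le => e e0.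
apply: filterS (near_lim e e0) => F FG; apply: sup_norm_le => A.
by rewrite charge_ofB distrC.
Unshelve. all: by end_near. Qed.

HB.instance Definition _ := Uniform_isComplete.Build (diffuse R) diffuse_complete.

End Diffuse.

(** * Splitting a periodic density into pieces *)

Lemma mean_sum (R : realType) (J : finType) p (F : J -> nat -> R) :
  (0 < p)%N -> (forall j, period p (F j)) ->
  mean (fun k => \sum_j F j k) = \sum_j mean (F j).
Proof.
move=> p0 Fp; rewrite (meanE (p := p)); last first.
  by split=> // k; apply: eq_bigr => j _; have [_ ->] := Fp j.
rewrite /avg exchange_big mulr_sumr.
by apply: eq_bigr => j _; rewrite (meanE (Fp j)).
Qed.

Section Split.
Variable R : realType.
Implicit Types (F G : diffuse R) (A : periodic_set) (h y : nat -> R).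

Definition with_density h (hP : periodic h) : diffuse R :=
  Diffuse (density_closed hP).

Lemma with_density_dense F (e : R) : 0 < e ->
  exists h, exists hP : periodic h, `|F - with_density hP| <= e.
Proof.
move=> e0; have /density_closureP/(_ e e0)[h hP Fh] := charge_ofP F.
by exists h, hP; apply: sup_norm_le.
Qed.

(** The support of the positive part of [h] for [s = false], of the negative part for [s = true]. *)
Definition sign_set (s : bool) h (hP : periodic h) : periodic_set.
Proof.
exists (fun k => 0 < (-1) ^+ s * h k).
exact: (periodic_comp (fun x => 0 < (-1) ^+ s * x) hP).
Defined.

(** A nonnegative weight does not create new signs, so the sign sets of [h] are extremal for [h * c]
    too. Used with [c = 1] for [h] itself and with a scaled block indicator for its pieces. *)
Lemma le_sign_set (s : bool) h (hP : periodic h) (c : nat -> R) A :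
  (forall k, 0 <= c k) -> periodic (fun k => h k * c k) ->
  (-1) ^+ s * density (fun k => h k * c k) A <=
  (-1) ^+ s * density (fun k => h k * c k) (sign_set s hP).
Proof.
move=> c0 hcP.
have P B := periodic_restrict B hcP.
rewrite -!(meanZ _ (P _)); apply: le_mean.
- exact: (periodic_comp (fun x => (-1) ^+ s * x) (P A)).
- exact: (periodic_comp (fun x => (-1) ^+ s * x) (P (sign_set s hP))).
move=> k /=; have ck := c0 k; rewrite !mulrA.
have [/ltW hk|hk] := ltP 0 ((-1) ^+ s * h k); rewrite ?mulr1 ?mulr0.
  by rewrite -[leRHS]mulr1 ler_wpM2l ?lern1 ?leq_b1// mulr_ge0.
by rewrite mulr_le0_ge0// mulr_le0_ge0.
Qed.

Lemma with_density_norm_le (h g : nat -> R) (hP : periodic h) (gP : periodic g) :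
  (forall s A, (-1) ^+ (s : bool) * density g A <= `|with_density hP|) ->
  `|with_density gP| <= `|with_density hP|.
Proof.
move=> H; apply: sup_norm_le => A; rewrite ler_norml lerNl.
by have := H true A; have := H false A; rewrite mul1r mulN1r => -> ->.
Qed.

(** By [le_sign_set] no set is charged more than the heavier of the positive and negative parts of
    [h]. *)
Lemma with_density_norm_attained h (hP : periodic h) :
  exists s, `|with_density hP| = `|density h (sign_set s hP)|.
Proof.
have le s A : (-1) ^+ (s : bool) * density h A <= `|density h (sign_set s hP)|.
  have e : h = fun k => h k * 1 by apply/funext => k; rewrite mulr1.
  have := @le_sign_set s h hP (fun=> 1) A (fun=> ler01); rewrite -e => /(_ hP).
  move/le_trans; apply; apply: le_trans (ler_norm _) _.
  by rewrite normrM normrX normrN1 expr1n mul1r.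
have /orP[d|d] := le_total `|density h (sign_set true hP)|
                           `|density h (sign_set false hP)|;
  [exists false|exists true]; apply/eqP; rewrite eq_le;
  (apply/andP; split; last exact: (le_sup_norm (with_density hP)));
  apply: sup_norm_le => A; rewrite ler_norml lerNl;
  have := le true A; have := le false A; rewrite mul1r mulN1r => ? ?;
  by apply/andP; split => //; apply: le_trans d.
Qed.

Variables (h : nat -> R) (p m : nat).
Hypotheses (hP : periodic h) (hp : period p h) (m0 : (0 < m)%N).

Let p0 : (0 < p)%N. Proof. by case: hp. Qed.

(** The factor [m] compensates for the share 1/m of a block; the bracketing exhibits the nonnegative
    weight expected by [le_sign_set]. *)
Definition piece (j : 'I_m) : nat -> R :=
  fun k => h k * (m%:R * (block p m j k)%:R).

Lemma piece_periodic j : periodic (piece j).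
Proof.
apply: (periodic_op2 (fun x (b : bool) => x * (m%:R * b%:R))) => //.
by exists (m * p)%N; exact: block_period.
Qed.

(** Since [A] has the period [p] as well, [g] restricted to [A] is [p]-periodic and [mean_block]
    applies. *)
Lemma density_piece (j : 'I_m) (g : nat -> R) A : period p g -> period p (sval A) ->
  mean (fun k => g k * (sval A k && block p m j k)%:R) = m%:R^-1 * density g A.
Proof.
move=> gp Ap; rewrite /density -(mean_block (p := p) (ltn_ord j)).
  by congr mean; apply/funext => k; rewrite -mulrA -natrM mulnb.
exact: (period_op2 (fun x (b : bool) => x * b%:R)).
Qed.

Lemma sign_set_period s : period p (sval (sign_set s hP)).
Proof. exact: (period_comp (fun x => 0 < (-1) ^+ s * x) hp). Qed.

Lemma density_piece_sign j s :
  density (piece j) (sign_set s hP) = density h (sign_set s hP).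
Proof.
have m1 : m%:R != 0 :> R by rewrite pnatr_eq0; lia.
rewrite -[RHS](mulVKf m1) -(density_piece j hp (sign_set_period s)) -meanZ.
  by congr mean; apply/funext => k; rewrite /piece -mulnb natrM; ring.
apply: (periodic_op2 (fun x (b : bool) => x * b%:R)) => //.
apply: (periodic_op2 andb); first by exists p; exact: sign_set_period.
by exists (m * p)%N; exact: block_period.
Qed.

(** It suffices to test on the sign sets of [h], and there the piece has the same charge as [h]. *)
Lemma piece_norm_le j :
  `|with_density (piece_periodic j)| <= `|with_density hP|.
Proof.
apply: with_density_norm_le => s A.
have := @le_sign_set s h hP (fun k => m%:R * (block p m j k)%:R) A.
move/(_ (fun k => mulr_ge0 (ler0n _ _) (ler0n _ _)) (piece_periodic j)).
move/le_trans; apply; rewrite -/(piece j) density_piece_sign.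
apply: le_trans (ler_norm _) _; rewrite normrM normrX normrN1 expr1n mul1r.
exact: (le_sup_norm (with_density hP)).
Qed.

Lemma sum_piece :
  \sum_(j < m) with_density (piece_periodic j) = m%:R *: with_density hP.
Proof.
apply/val_inj/funext => A /=.
rewrite (big_morph (fun F => charge_of F A) (id1 := 0) (op1 := +%R))//=.
rewrite -[RHS](meanZ _ (periodic_restrict A hP)).
case: (svalP A) => q Aq.
(* The set [A] has its own period [q], unrelated to [p], hence this common period. *)
rewrite -(mean_sum (p := m * p * q)).
- congr mean; apply/funext => k.
  (* Each [k] lies in exactly one block, that of the residue of [k %/ p] modulo [m]. *)
  rewrite /piece (bigD1 (Ordinal (ltn_pmod (k %/ p)%N m0)))//= big1.
    by rewrite addr0 /block eqxx mulr1 -mulrA mulrCA.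
  move=> j /negP jk; rewrite /block.
  have /negbTE -> : ((k %/ p) %% m)%N != j.
    by apply/negP => /eqP e; apply: jk; apply/eqP/val_inj.
  by rewrite !(mulr0, mul0r).
- by case: Aq => q0 _; rewrite !muln_gt0 m0 p0.
- move=> j; apply: (period_op2 (fun x (b : bool) => x * b%:R)).
    apply: (period_mulr); first by case: Aq.
    apply: (period_op2 (fun x (b : bool) => x * (m%:R * b%:R))).
      exact: period_mull.
    exact: block_period.
  by apply: period_mull => //; rewrite muln_gt0 m0.
Qed.

(** By [sum_piece], [h] is the average of its pieces, so [f] cannot be smaller on all of them. *)
Lemma exists_piece_ge (f : {linear diffuse R -> R^o}) :
  exists j, f (with_density hP) <= f (with_density (piece_periodic j)).
Proof.
apply: contrapT => H.
have {}H j : f (with_density (piece_periodic j)) < f (with_density hP).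
  by rewrite ltNge; apply/negP => ?; apply: H; exists j.
have : \sum_(j < m) f (with_density (piece_periodic j)) <
       \sum_(j < m) f (with_density hP).
  apply: ltr_sum => //; apply/hasP.
  by exists (Ordinal m0); rewrite ?mem_index_enum.
by rewrite -linear_sum sum_piece linearZ /= sumr_const card_ord scaler_nat ltxx.
Qed.

(** The test set is the part in block [j] of a sign set [C] norming [h]: the piece charges it as
    much as [h] charges [C], while [y] puts there only 1/m of its charge of [C]. *)
Lemma piece_far j y (yP : periodic y) : period p y ->
  `|with_density hP| - m%:R^-1 * `|with_density yP| <=
  `|with_density (piece_periodic j) - with_density yP|.
Proof.
move=> yp; have [s hs] := with_density_norm_attained hP.
have Cp := sign_set_period s; set C := sign_set s hP in hs Cp.
have BP : periodic (fun k => sval C k && block p m j k).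
  apply: (periodic_op2 andb); first by exists p.
  by exists (m * p)%N; exact: block_period.
pose B : periodic_set := exist _ _ BP.
apply: le_trans (le_sup_norm _ B); rewrite charge_ofB /=.
have -> : density (piece j) B = density h C.
  rewrite -(density_piece_sign j s) /density; congr mean; apply/funext => k /=.
  by rewrite -mulnb natrM /piece; case: (block _ _ _ _); rewrite ?mulr0 ?mul0r ?mulr1.
rewrite [density y B](density_piece j yp Cp) hs.
apply: le_trans (lerB_dist _ _); rewrite lerB// normrM ger0_norm ?invr_ge0//.
by rewrite ler_wpM2l ?invr_ge0// (le_sup_norm (with_density yP)).
Qed.

End Split.

(** * Functionals of norm one *)

Section DualSphere.
Variables (R : realType) (X : normedModType R) (f : {linear X -> R^o}).
Hypothesis fS : dual_sphere f.

Lemma dual_sphere_le x : `|f x| <= `|x|.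
Proof.
have [->|x0] := eqVneq x 0; first by rewrite linear0 !normr0.
have nx : 0 < `|x| by rewrite normr_gt0.
have : ((`|f (`|x|^-1 *: x)|)%:E <= 1%:E :> \bar R)%E.
  have [_ <-] := fS; apply: ereal_sup_ubound; exists (`|x|^-1 *: x) => //.
  by rewrite /unit_ball /= normrZV// unitfE normr_eq0.
by rewrite lee_fin linearZ /= normrZ normfV normr_id ler_pdivrMl// mulr1.
Qed.

Lemma dual_sphere_near_norming d : 0 < d -> exists2 x, unit_ball x & 1 - d < f x.
Proof.
move=> d0; have [_ f1] := fS.
have : ((1 - d)%:E < dual_norm f)%E by rewrite f1 lte_fin; lra.
move=> /ereal_sup_gt[_ [x xB <-]]; rewrite lte_fin => fx.
have [fx0|fx0] := leP 0 (f x); first by exists x => //; rewrite ger0_norm in fx.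
(* The supremum controls only the absolute value of [f x], so a negative value is repaired by
   passing to [- x]. *)
exists (- x); first by rewrite /unit_ball /= normrN.
by rewrite linearN -(ltr0_norm fx0).
Qed.

End DualSphere.

(** * Every slice has radius one *)

Section Slices.
Variable R : realType.
Local Notation X := (diffuse R).

(** An approximating density may leave the unit ball; it is scaled back by 1 + t, with an error [t]
    small enough to stay in the slice. *)
Lemma slice_density (f : {linear X -> R^o}) (d : R) : dual_sphere f -> 0 < d ->
  exists h, exists hP : periodic h,
    `|with_density hP| <= 1 /\ 1 - d < f (with_density hP).
Proof.
move=> fS d0; wlog d1 : d d0 / d < 1.
  move=> H; have [] := H (Num.min d 2^-1); first by rewrite lt_min d0; lra.
    by rewrite gt_min orbC (_ : 2^-1 < 1)//; lra.
  move=> h [hP [h1 hf]]; exists h, hP; split => //; apply: le_lt_trans hf.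
  by rewrite lerB// ge_min lexx.
have [x xB fx] := dual_sphere_near_norming fS d0.
(* Half the margin of [x]: then f x - t = 1 - d + t, which exceeds (1 + t)(1 - d) by t d. *)
pose t := (f x - 1 + d) / 2.
have t0 : 0 < t by rewrite /t; lra.
have [h0 [h0P xh]] := with_density_dense x t0.
have ht : `|with_density h0P| <= 1 + t.
  rewrite -[with_density h0P](subrK x) addrC (le_trans (ler_normD _ _))//.
  by rewrite lerD// distrC.
have fh : f x - t <= f (with_density h0P).
  rewrite lerBlDr -lerBlDl -linearB (le_trans (ler_norm _))//.
  by rewrite (le_trans (dual_sphere_le fS _)).
have c0 : 0 < (1 + t)^-1 by rewrite invr_gt0; lra.
have hP : periodic (fun k => (1 + t)^-1 * h0 k).
  exact: (periodic_comp (fun x => (1 + t)^-1 * x) h0P).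
exists _, hP.
have -> : with_density hP = (1 + t)^-1 *: with_density h0P.
  by apply/val_inj; rewrite /= densityZ.
split; first by rewrite normrZ gtr0_norm// ler_pdivrMl ?mulr1//; lra.
rewrite linearZ /= ltr_pdivlMl; last by lra.
apply: lt_le_trans fh.
have td : t * d > 0 by exact: mulr_gt0.
have tE : t * 2 = f x - 1 + d by rewrite /t; field.
nra.
Qed.

Lemma slice_far (f : {linear X -> R^o}) (a : R) (x : X) (e : R) :
  dual_sphere f -> 0 < a -> 0 < e ->
  exists2 z, slice f a z & 1 - e < `|z - x|.
Proof.
move=> fS a0 e0.
(* Three losses of at most e/3 each: the defect of the norm of [h] from 1, the replacement of [x] by
   the density [y], and the share of [y] on one block. The bound by [a] keeps the point in the
   slice. *)
pose d := Num.min a (e / 3).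
have d0 : 0 < d by rewrite lt_min a0; lra.
have [h [hP [h1 fh]]] := slice_density fS d0.
have e30 : 0 < e / 3 by lra.
have [y [yP xy]] := with_density_dense x e30.
have [p [hp yp]] := common_period hP yP.
have [m m0 ym] : exists2 m, (0 < m)%N & m%:R^-1 * `|with_density yP| <= e / 3.
  exists (Num.bound (`|with_density yP| / (e / 3))).+1 => //.
  rewrite ler_pdivrMl// mulrC -ler_pdivrMl// mulrC; apply: ltW.
  rewrite (lt_trans (archi_boundP _))// ?ltr_nat// divr_ge0//; lra.
have [j fj] := exists_piece_ge hP hp m0 f.
exists (with_density (piece_periodic hP hp m0 j)).
  split; first exact: le_trans (piece_norm_le hP hp m0 j) h1.
  apply: lt_le_trans fj; apply: le_lt_trans fh.
  by rewrite lerB// ge_min lexx.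
have far := piece_far hP hp m0 j yP yp.
set w := with_density (piece_periodic _ _ _ _) in far *.
have tri := ler_distD x w (with_density yP).
have nf := le_trans (ler_norm _) (dual_sphere_le fS (with_density hP)).
have de : d <= e / 3 by rewrite ge_min lexx orbT.
have {far tri} : `|with_density hP| - e / 3 <= `|w - x| + e / 3.
  apply: le_trans (lerB (lexx _) ym) _; apply: le_trans far _.
  by apply: le_trans tri _; rewrite lerD2l.
move: de; have := lt_le_trans fh nf.
move: `|with_density hP| `|w - x| (d) => N W d'; lra.
Qed.

(** The center is arbitrary, so the bound serves both [radius] and [Ts]. *)
Lemma slice_ball_ge1 (S : set X) (x : X) (r : R) :
  is_slice S -> 0 < r -> S `<=` closed_ball x r -> 1 <= r.
Proof.
move=> [f [a [fS a0 ->]]] r0 Sr; rewrite leNgt; apply/negP => r1.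
have e0 : 0 < 1 - r by lra.
have [z /Sr + zx] := slice_far x fS a0 e0.
by rewrite closed_ballE// /closed_ball_ /= distrC leNgt; rewrite subKr in zx; rewrite zx.
Qed.

Lemma diffuse_r_big_slice : r_big_slice_property X.
Proof.
move=> S Ss; apply/eqP; rewrite eq_le; apply/andP; split.
  apply: ereal_inf_lbound; exists 1 => //; split => //; exists 0.
  move: Ss => [f [a [_ _ ->]]] z [zB _].
  by rewrite closed_ballE// /closed_ball_ /= sub0r normrN.
apply: le_ereal_inf_tmp => _ [r [r0 [x Sr]] <-].
by rewrite lee_fin; exact: slice_ball_ge1 Sr.
Qed.

Lemma diffuse_Ts_ge1 : (1%:E <= Ts X)%E.
Proof.
apply: le_ereal_inf_tmp => _ [r [r0 [x [S [_ Ss Sr]]]] <-].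
by rewrite lee_fin; exact: slice_ball_ge1 Sr.
Qed.

(** * The total mass functional and its small slices *)

Definition total_mass (F : X) : R^o := F full_set.

Lemma total_mass_linear : linear total_mass.
Proof. by []. Qed.

HB.instance Definition _ :=
  GRing.isLinear.Build R X R^o *:%R total_mass total_mass_linear.

Lemma total_mass_le F : `|total_mass F| <= `|F|.
Proof. exact: le_sup_norm. Qed.

Lemma total_mass_dual_sphere : dual_sphere (total_mass : {linear X -> R^o}).
Proof.
split.
  move=> F B /nbhs_ballP[e e0 eB]; apply/nbhs_ballP; exists e => // G.
  rewrite -ball_normE /= => FG; apply: eB; rewrite -ball_normE /=.
  by rewrite -linearB (le_lt_trans (total_mass_le _)).
(* The constant density 1 lies in the unit ball and has total mass 1, so the functional attains its
   norm there. *)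
have oneP : periodic (fun _ : nat => 1 : R) by exists 1%N.
have one_mass : total_mass (with_density oneP) = 1.
  rewrite /total_mass /= /density -[RHS](mean_cst (1 : R)); congr mean.
  by apply/funext => k; rewrite mulr1.
apply/eqP; rewrite eq_le; apply/andP; split.
  apply: ge_ereal_sup => _ [F FB <-]; rewrite lee_fin.
  exact: le_trans (total_mass_le F) FB.
apply: ereal_sup_ubound; exists (with_density oneP); last first.
  by rewrite -[RHS](congr1 EFin (normr1 R)) -[in RHS]one_mass.
apply: sup_norm_le => A; apply: le_trans (le_norm_density A oneP) _.
by rewrite normr1 mean_cst.
Qed.

Definition compl_set (A : periodic_set) : periodic_set.
Proof.
exists (fun k => ~~ sval A k).
exact: (periodic_comp negb (svalP A)).
Defined.

(** Additivity holds for densities and survives uniform limits: three values are approximated, each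
    within e/3. *)
Lemma total_mass_compl (F : X) A : total_mass F = F A + F (compl_set A).
Proof.
apply/eqP; rewrite -subr_eq0 -normr_le0; apply/ler_addgt0Pr => e e0; rewrite add0r.
have e30 : 0 < e / 3 by lra.
have /density_closureP/(_ _ e30)[h hP Fh] := charge_ofP F.
have hE : density h full_set = density h A + density h (compl_set A).
  rewrite -meanD; [|exact: periodic_restrict..].
  by congr mean; apply/funext => k /=; case: (sval A k); rewrite !(mulr1, mulr0, addr0, add0r).
have := Fh A; have := Fh (compl_set A); have := Fh full_set.
rewrite /total_mass; move: hE; move: (F _) (F _) (F _) (density _ _) (density _ _) (density _ _).
move=> u v w u' v' w' E; rewrite !ler_norml => /andP[? ?] /andP[? ?] /andP[? ?].
by apply/andP; split; lra.
Qed.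

Lemma total_mass_slice_diam (a : R) : 0 < a ->
  (diam (slice total_mass a) <= (1 + a)%:E)%E.
Proof.
move=> a0; apply: ge_ereal_sup => _ [[F G] /= [[FB Fa] [GB Ga]] <-].
(* One-sided and asymmetric in [H] and [K]; applying it to both orders of [F] and [G] bounds the
   absolute value. *)
have le (H K : X) B : unit_ball H -> unit_ball K -> 1 - a < total_mass K ->
    H B - K B <= 1 + a.
  move=> HB KB; rewrite (total_mass_compl K B) => Ka.
  have := le_trans (ler_norm _) (le_trans (le_sup_norm H B) HB).
  have := le_trans (ler_norm _) (le_trans (le_sup_norm K (compl_set B)) KB).
  by lra.
rewrite lee_fin; apply: sup_norm_le => B; rewrite charge_ofB ler_norml.
by rewrite lerNl opprB !le.
Qed.

Lemma diffuse_nontrivial : nontrivial X.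
Proof.
(* With tolerance 1 this yields a point of positive total mass. *)
have [x _ fx] := dual_sphere_near_norming total_mass_dual_sphere ltr01.
by exists x; apply: contraTneq fx => ->; rewrite linear0 subrr ltxx.
Qed.

End Slices.

Theorem theorem3p7 (R : realType) :
  exists X : completeNormedModType R,
    [/\ nontrivial X,
        r_big_slice_property X,
        (1%:E <= Ts X)%E
      & exists phi : {linear X -> R^o},
          dual_sphere phi /\
          (ereal_inf [set diam (slice phi a) | a in [set a : R | (0 < a)%R]]
            <= (Num.sqrt (2 : R))%:E)%E].
Proof.
exists (diffuse R); split.
- exact: diffuse_nontrivial.
- exact: diffuse_r_big_slice.
- exact: diffuse_Ts_ge1.
exists (@total_mass R); split; first exact: total_mass_dual_sphere.
(* For this width the diameter bound 1 + a is exactly the square root of 2. *)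
have a0 : 0 < Num.sqrt 2 - 1 :> R by rewrite subr_gt0 -{1}sqrtr1 ltr_sqrt// ltr1n.
apply: ge_ereal_inf; exists (diam (slice (@total_mass R) (Num.sqrt 2 - 1))).
  by exists (Num.sqrt 2 - 1).
by apply: le_trans (total_mass_slice_diam a0) _; rewrite addrC subrK.
Qed.
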